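(* Let $B$ be a Polish metric space and let $\mathscr{U}_B=(U,d_U,\pi_U)$ be the Urysohn field over $B$. The moduli space $(\mathcal{F}_B,d_{GH})$ of isometry classes of compact $B$-fields, equipped with the Gromov-Hausdorff distance, is isometric to the quotient space $(F(\mathscr{U}_B)/\mathrm{Aut}(B),\,d_F^B)$.
   Context: A Polish metric space is a complete separable metric space. Fix a Polish metric space $(B,d_B)$. A $B$-field is a triple $\mathcal{X}=(X,d_X,\pi_X)$, where $(X,d_X)$ is a nonempty Polish metric space and $\pi_X\colon X\to B$ is 1-Lipschitz; it is compact if $X$ is compact. An isometric embedding $\Phi\colon\mathcal{X}\Rightarrow\mathcal{Y}$ over $B$ is a distance-preserving map $\phi\colon X\to Y$ with $\pi_Y\circ\phi=\pi_X$; it is an isometry if $\phi$ is also bijective, and two $B$-fields are isometric if there is an isometry between them. An automorphism of a $B$-field is an isometry from it to itself. The Gromov-Hausdorff distance between $B$-fields is $d_{GH}(\mathcal{X},\mathcal{Y}) := \inf_{\mathcal{Z},\Phi,\Psi} d_H^Z(\phi(X),\psi(Y))$, where the infimum is over all $B$-fields $\mathcal{Z}=(Z,d_Z,\pi_Z)$ and all isometric embeddings $\Phi\colon\mathcal{X}\Rightarrow\mathcal{Z}$, $\Psi\colon\mathcal{Y}\Rightarrow\mathcal{Z}$ over $B$, and $d_H^Z$ is the Hausdorff distance in $Z$. A $B$-field $\pi\colon U\to B$ is a Urysohn field over $B$ if for each finite subspace $A$ of $U$ (possibly empty) and each 1-Lipschitz map $\phi\colon A^\ast\to B$ defined on a one-point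 metric extension $A^\ast=A\sqcup\{a^\ast\}$ of $A$ with $\phi|_A=\pi|_A$, there is an isometric embedding $\imath\colon A^\ast\to U$ such that $\imath|_A$ is the inclusion and $\pi\circ\imath=\phi$. It is known that a Urysohn field over $B$ exists, is unique up to isometry, and that every $B$-field embeds isometrically over $B$ in it. $F(\mathscr{U}_B)$ is the set of compact subfields of $\mathscr{U}_B$ (nonempty compact subsets $X\subseteq U$ with the restricted metric and the restriction of $\pi_U$), equipped with the Hausdorff distance $d_H^U$. $\mathrm{Aut}(B)$ denotes the group of automorphisms of $\mathscr{U}_B$, acting on $F(\mathscr{U}_B)$ by $X\mapsto\psi(X)$. The quotient metric on $F(\mathscr{U}_B)/\mathrm{Aut}(B)$ is $$d_F^B(X,Y)=\inf_{\psi\in \mathrm{Aut}(B)}d_H^U(X,\psi(Y)).$$ *)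

(* Defs.v *)
From HB Require Import structures.
From mathcomp Require Export all_boot all_order all_algebra.
From mathcomp Require Export boolp classical_sets functions cardinality filter.
From mathcomp Require Export reals ereal topology.

Set Implicit Arguments.
Unset Strict Implicit.
Unset Printing Implicit Defensive.

Import Order.TTheory GRing.Theory Num.Theory.
Local Open Scope classical_set_scope.
Local Open Scope ring_scope.

(* [completeType] is not used because it carries a chosen point, which the base
   space of a field need not have. *)
Definition complete_space (T : uniformType) : Prop :=
  forall F : set_system T, ProperFilter F -> cauchy F -> exists x : T, F --> x.

Definition separable (T : topologicalType) : Prop :=
  exists2 S : set T, countable S & dense S.

Definition polish_metric (R : realType) (T : metricType R) : Prop :=
  complete_space T /\ separable T.

Definition distance_preserving (R : realType) (X Y : metricType R)
  (f : X -> Y) : Prop := forall x y, mdist (f x) (f y) = mdist x y.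

(* [k.-lipschitz] of normed_module is restricted to normed modules. *)
Definition one_lipschitz (R : realType) (X Y : metricType R)
  (f : X -> Y) : Prop := forall x y, mdist (f x) (f y) <= mdist x y.

Record field_over (R : realType) (B : metricType R) := FieldOver {
  carrier :> metricType R ;
  proj : carrier -> B ;
  carrier_polish : polish_metric carrier ;
  carrier_neq0 : [set: carrier] !=set0 ;
  proj_lipschitz : one_lipschitz proj }.

Section Fields.
Context (R : realType) (B : metricType R).

Definition embedding_over (X Y : field_over B) (phi : X -> Y) : Prop :=
  distance_preserving phi /\ forall x, proj (phi x) = proj x.

Definition isometry_over (X Y : field_over B) (phi : X -> Y) : Prop :=
  embedding_over phi /\ bijective phi.

Definition isometric_over (X Y : field_over B) : Prop :=
  exists phi : X -> Y, isometry_over phi.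

Definition automorphism (X : field_over B) (psi : X -> X) : Prop :=
  isometry_over psi.

End Fields.

(* The distances below take values in [\bar R]; this is how the infima and
   suprema make sense without a boundedness or nonemptiness proviso. *)
Definition hausdorff_dist (R : realType) (Z : metricType R) (A C : set Z)
    : \bar R :=
  maxe (ereal_sup [set ereal_inf [set (mdist a c)%:E | c in C] | a in A])
       (ereal_sup [set ereal_inf [set (mdist a c)%:E | a in A] | c in C]).

Definition GH_dist (R : realType) (B : metricType R) (X Y : field_over B)
    : \bar R :=
  ereal_inf [set r | exists (Z : field_over B) (phi : X -> Z) (psi : Y -> Z),
    [/\ embedding_over phi, embedding_over psi &
        r = hausdorff_dist (range phi) (range psi)]].

(* A one-point metric extension of [A] is a metric space [As] with a
   distance-preserving map [j] from [A] (with the metric of [U]) and a point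
   [a] outside the image of [j] that together with this image exhausts [As]. *)
Definition one_point_extension (R : realType) (U : metricType R) (A : set U)
    (As : metricType R) (j : A -> As) (a : As) : Prop :=
  [/\ forall x y : A, mdist (j x) (j y) = mdist (val x) (val y),
      forall x : A, j x <> a &
      forall z : As, z = a \/ exists x : A, z = j x].

Definition urysohn_field (R : realType) (B : metricType R) (U : field_over B)
    : Prop :=
  forall (A : set U), finite_set A ->
  forall (As : metricType R) (j : A -> As) (a : As),
    one_point_extension j a ->
  forall phi : As -> B, one_lipschitz phi ->
    (forall x : A, phi (j x) = proj (val x)) ->
  exists i : As -> U,
    [/\ distance_preserving i,
        forall x : A, i (j x) = val x &
        forall z : As, proj (i z) = phi z].

(* The set of equivalence classes of a relation, as predicates: [set T] is not
   available because its universe lies below that of the type of all fields over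
   [B]. A distance passes to the quotient by evaluation at representatives; [class_distE] shows that the
   choice of representatives is immaterial when the distance is invariant. *)
Definition classes (T : Type) (r : T -> T -> Prop) : Type :=
  {C : T -> Prop | exists x, C = r x}.

Definition class_of (T : Type) (r : T -> T -> Prop) (x : T) : classes r :=
  exist _ (r x) (ex_intro _ x erefl).

Definition representative (T : Type) (r : T -> T -> Prop) (C : classes r) : T :=
  projT1 (cid (proj2_sig C)).

Definition class_dist (R : realType) (T : Type) (r : T -> T -> Prop)
  (d : T -> T -> \bar R) (C D : classes r) : \bar R :=
  d (representative C) (representative D).

Lemma class_distE (R : realType) (T : Type) (r : T -> T -> Prop)
    (d : T -> T -> \bar R) :
  (forall x, r x x) ->
  (forall x x' y y', r x x' -> r y y' -> d x y = d x' y') ->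
  forall x y, class_dist d (class_of r x) (class_of r y) = d x y.
Proof.
move=> rr dr x y.
have rep z : r (representative (class_of r z)) z.
  rewrite /representative; case: cid => w /= <-.
  exact: rr.
by apply: dr; apply: rep.
Qed.

Definition isometric_spaces (R : realType) (S T : Type)
    (dS : S -> S -> \bar R) (dT : T -> T -> \bar R) : Prop :=
  exists f : S -> T, bijective f /\ forall x y, dT (f x) (f y) = dS x y.

Section ModuliSpace.
Context (R : realType) (B : metricType R).

Definition compact_field : Type :=
  {X : field_over B | compact [set: X]}.

Definition compact_field_isometric (X Y : compact_field) : Prop :=
  isometric_over (proj1_sig X) (proj1_sig Y).

Definition compact_field_GH_dist (X Y : compact_field) : \bar R :=
  GH_dist (proj1_sig X) (proj1_sig Y).

Definition moduli_space : Type := classes compact_field_isometric.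

Definition moduli_dist : moduli_space -> moduli_space -> \bar R :=
  class_dist compact_field_GH_dist.

End ModuliSpace.

Section OrbitSpace.
Context (R : realType) (B : metricType R) (U : field_over B).

Definition compact_subfield : Type :=
  {K : set U | compact K /\ K !=set0}.

Definition same_orbit (X Y : compact_subfield) : Prop :=
  exists2 psi : U -> U, automorphism psi & proj1_sig Y = psi @` proj1_sig X.

Definition F_dist (X Y : compact_subfield) : \bar R :=
  ereal_inf [set hausdorff_dist (proj1_sig X) (psi @` proj1_sig Y)
            | psi in [set psi : U -> U | automorphism psi]].

Definition orbit_space : Type := classes same_orbit.

Definition orbit_dist : orbit_space -> orbit_space -> \bar R :=
  class_dist F_dist.

End OrbitSpace.

Section WellDefined.
Context (R : realType) (B : metricType R).
Implicit Types X Y Z : field_over B.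

Lemma isometry_over_id X : isometry_over (@id X).
Proof. by split; [split|exists id]. Qed.

Lemma embedding_over_comp X Y Z (g : Y -> Z) (f : X -> Y) :
  embedding_over g -> embedding_over f -> embedding_over (g \o f).
Proof.
by move=> [gd gp] [fd fp]; split=> [x y|x] /=; rewrite ?gd ?fd ?gp ?fp.
Qed.

Lemma isometry_over_comp X Y Z (g : Y -> Z) (f : X -> Y) :
  isometry_over g -> isometry_over f -> isometry_over (g \o f).
Proof.
move=> [ge gb] [fe fb]; split; first exact: embedding_over_comp.
exact: bij_comp.
Qed.

Lemma isometry_over_inv X Y (f : X -> Y) : isometry_over f ->
  exists g : Y -> X, [/\ isometry_over g, cancel f g & cancel g f].
Proof.
move=> [[fd fp] [g fK gK]]; exists g; split=> //; split; last by exists f.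
by split=> [x y|x]; rewrite -?fd -?fp ?gK.
Qed.

Lemma isometric_over_refl X : isometric_over X X.
Proof. by exists id; exact: isometry_over_id. Qed.

Lemma isometric_over_sym X Y : isometric_over X Y -> isometric_over Y X.
Proof. by move=> [f /isometry_over_inv[g [gi _ _]]]; exists g. Qed.

Lemma isometric_over_trans X Y Z :
  isometric_over X Y -> isometric_over Y Z -> isometric_over X Z.
Proof.
by move=> [f fi] [g gi]; exists (g \o f); exact: isometry_over_comp.
Qed.

Lemma GH_dist_isometric X X' Y Y' : isometric_over X X' ->
  isometric_over Y Y' -> GH_dist X Y = GH_dist X' Y'.
Proof.
have range_comp (V W Z : field_over B) (h : V -> W) (f : W -> Z) :
    bijective h -> range (f \o h) = range f.
  move=> [k hK kK]; apply/seteqP; split=> z [w _ <-] /=; first by exists (h w).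
  by exists (k w) => //=; rewrite kK.
have sub (V V' W W' : field_over B) (h : V' -> V) (k : W' -> W) :
    isometry_over h -> isometry_over k ->
    [set r : \bar R | exists (Z : field_over B) (phi : V -> Z) (psi : W -> Z),
      [/\ embedding_over phi, embedding_over psi &
        r = hausdorff_dist (range phi) (range psi)]] `<=`
    [set r | exists (Z : field_over B) (phi : V' -> Z) (psi : W' -> Z),
      [/\ embedding_over phi, embedding_over psi &
        r = hausdorff_dist (range phi) (range psi)]].
  move=> [he hb] [ke kb] _ [Z [phi [psi [phie psie ->]]]].
  exists Z, (phi \o h), (psi \o k).
  by split; [exact: embedding_over_comp..|rewrite !range_comp].
move=> [f fi] [g gi].
have [f' [f'i _ _]] := isometry_over_inv fi.
have [g' [g'i _ _]] := isometry_over_inv gi.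
by congr ereal_inf; apply/seteqP; split; [exact: sub f'i g'i|exact: sub fi gi].
Qed.

Lemma hausdorff_dist_image (Z W : metricType R) (f : Z -> W) (A C : set Z) :
  distance_preserving f ->
  hausdorff_dist (f @` A) (f @` C) = hausdorff_dist A C.
Proof.
move=> fd; rewrite /hausdorff_dist !image_comp.
congr (maxe (ereal_sup _) (ereal_sup _)); apply: eq_imagel => x _ /=;
  rewrite image_comp; congr ereal_inf; apply: eq_imagel => y _ /=;
  by rewrite fd.
Qed.

Lemma same_orbit_refl (U : field_over B) (X : compact_subfield U) :
  same_orbit X X.
Proof. by exists id; [exact: isometry_over_id|rewrite image_id]. Qed.

Lemma F_dist_same_orbit (U : field_over B) (X X' Y Y' : compact_subfield U) :
  same_orbit X X' -> same_orbit Y Y' -> F_dist X Y = F_dist X' Y'.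
Proof.
move=> [f fa XE] [g ga YE].
have [f' [f'a fK f'K]] := isometry_over_inv fa.
have [g' [g'a gK g'K]] := isometry_over_inv ga.
congr ereal_inf; rewrite XE YE; apply/seteqP; split=> _ [psi psia <-].
  exists (f \o psi \o g').
    by apply: isometry_over_comp => //; exact: isometry_over_comp.
  rewrite -[RHS](hausdorff_dist_image _ _ fa.1.1) !image_comp.
  by congr hausdorff_dist; apply: eq_imagel => y _ /=; rewrite gK.
exists (f' \o psi \o g).
  by apply: isometry_over_comp => //; exact: isometry_over_comp.
rewrite -[LHS](hausdorff_dist_image _ _ fa.1.1) !image_comp.
by congr hausdorff_dist; apply: eq_imagel => y _ /=; rewrite f'K.
Qed.

Lemma moduli_distE (X Y : compact_field B) :
  moduli_dist (class_of _ X) (class_of _ Y) =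
  GH_dist (proj1_sig X) (proj1_sig Y).
Proof.
apply: class_distE => [Z|V V' W W'];
  [exact: isometric_over_refl|exact: GH_dist_isometric].
Qed.

Lemma orbit_distE (U : field_over B) (X Y : compact_subfield U) :
  orbit_dist (class_of _ X) (class_of _ Y) = F_dist X Y.
Proof.
by apply: class_distE; [exact: same_orbit_refl|exact: F_dist_same_orbit].
Qed.

End WellDefined.

(* Main.v *)
From HB Require Import structures.
Require Import Defs.
From mathcomp Require Import lra.

(** The Urysohn field U is at once universal, every field over B embeds in it,
and homogeneous over compact fields: two embeddings f, g of a compact field
in U differ by an automorphism of U ([urysohn_universal],
[urysohn_homogeneous]). These two facts give the theorem. Send a compact field
X to the orbit of f(X), for any embedding f of X in U. By homogeneity, f(X) and
g(Y) lie in one orbit exactly when X and Y are isometric over B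
([isometric_range_orbit]); so the map is well defined and injective, and it is
surjective because a compact subset of U is itself a compact field. It
preserves distances because the two infima run over the same set of numbers
([GH_dist_embedded]): a field Z receiving X and Y embeds in U, and there
homogeneity carries the image of X to f(X) and that of Y to psi(g(Y)) for an
automorphism psi.

Both facts about U come from the extension of partial isometries over B between
two fields, encoded as sets of pairs. If the domain of a partial isometry P into
U is totally bounded, a further point x can be added to it: the distances from x
prescribe, on the range of P, the distances to the point that has to be found in
U ([extend_domain]). Treating the points of a dense sequence one after the other
yields a partial isometry with dense domain, which extends to the whole space by
completeness; this gives universality, starting from the empty set. Treating
alternately points of the domain and of the range (back and forth), starting
from the graph of f(x) |-> g(x), gives homogeneity.

The defining property of U finds points with prescribed distances to a finite
set only. Passing to totally bounded sets ([realize_totally_bounded]) is the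
analytic core. A point v which is wrong by at most r on K is corrected by
applying the property to a finite net of K together with v itself, the new point
being asked to lie at distance at most r from v ([realize_closer]). With errors
2^-n the corrections converge, and the limit is exact. *)

Set Implicit Arguments.
Unset Strict Implicit.
Unset Printing Implicit Defensive.

Import Order.TTheory GRing.Theory Num.Theory.
Import metricType_numDomainType.

Local Open Scope classical_set_scope.
Local Open Scope ring_scope.

(** * Metrics from distance functions, and metric subspaces *)

Record distance_on (R : realType) (T : Type) := DistanceOn {
  distance :> T -> T -> R ;
  distancexx : forall x, distance x x = 0 ;
  distance_eq0 : forall x y, distance x y = 0 -> x = y ;
  distanceC : forall x y, distance x y = distance y x ;
  distance_triangle : forall y x z,
    distance x z <= distance x y + distance y z }.

(** A copy of [T] indexed by the distance, so that the metric structure can be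
found from the type alone. *)
Definition metrized (R : realType) (T : Type) (d : distance_on R T) : Type := T.

HB.instance Definition _ (R : realType) (T : choiceType)
    (d : distance_on R T) :=
  Choice.copy (metrized d) T.
HB.instance Definition _ (R : realType) (T : choiceType)
    (d : distance_on R T) :=
  isMetric.Build R (metrized d) (distancexx d) (@distance_eq0 _ _ d)
    (distanceC d) (distance_triangle d).

Lemma mdist_metrized (R : realType) (T : choiceType) (d : distance_on R T)
  (x y : metrized d) : mdist x y = d x y.
Proof. reflexivity. Qed.

Section SubspaceMetric.
Context (R : realType) (T : metricType R) (K : set T).

Let dist (x y : K) : R := mdist (set_val x) (set_val y).

Let dist_ge0 x y : 0 <= dist x y.
Proof. exact: mdist_ge0. Qed.

Let dist_positivity x y : dist x y = 0 -> x = y.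
Proof. by move=> /mdist_positivity/val_inj. Qed.

Let ball_dist x e : ball x e = [set y | dist x y < e].
Proof. by rewrite -initial_ballE ballEmdist. Qed.

HB.instance Definition _ :=
  PseudoMetric_isMetric.Build R K dist_ge0 dist_positivity ball_dist.

End SubspaceMetric.

(** * Complete, separable and totally bounded metric spaces *)

Lemma half_exp_lt (R : realType) (e : R) : 0 < e -> exists n, 2^-1 ^+ n < e.
Proof.
move=> e0; exists (Num.Def.archi_bound e^-1).
by rewrite exprVn invf_plt ?posrE ?exprn_gt0// upper_nthrootP.
Qed.

Lemma half_expS (R : realType) n : 2^-1 ^+ n.+1 = 2^-1 ^+ n / 2 :> R.
Proof. by rewrite exprSr. Qed.

Lemma half_exp_gt0 (R : realType) n : 0 < 2^-1 ^+ n :> R.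
Proof. by rewrite exprn_gt0. Qed.

(** Dependent choice for steps that depend on their rank, along an invariant
that depends on it too. *)
Lemma staged_choice (T : Type) (Q : nat -> T -> Prop)
    (S : nat -> T -> T -> Prop) :
  (forall n x, Q n x -> exists y, S n x y /\ Q n.+1 y) ->
  forall x0, Q 0 x0 ->
  exists u, u 0 = x0 /\ forall n, Q n (u n) /\ S n (u n) (u n.+1).
Proof.
move=> step x0 Q0; pose state := {nx : nat * T | Q nx.1 nx.2}.
have next (s : state) : {s' : state |
    (sval s').1 = (sval s).1.+1 /\ S (sval s).1 (sval s).2 (sval s').2}.
  apply: cid; case: s => -[n x] /= /step[y [Sxy Qy]].
  by exists (exist (fun nx => Q nx.1 nx.2) (n.+1, y) Qy).
have [u [u0 uS]] :=
  dependent_choice next (exist (fun nx => Q nx.1 nx.2) (0, x0) Q0).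
have un n : (sval (u n)).1 = n.
  by elim: n => [|n ih]; [rewrite u0|rewrite (uS n).1 ih].
exists (fun n => (sval (u n)).2); split=> [|n]; first by rewrite u0.
by have := proj2_sig (u n); have := (uS n).2; rewrite un.
Qed.

Section MetricSpaces.
Context (R : realType).
Implicit Types X Y : metricType R.

Lemma eq_mdist X (x y : X) : (forall e, 0 < e -> mdist x y <= e) -> x = y.
Proof.
move=> h; apply: mdist_positivity; apply/eqP; rewrite eq_le mdist_ge0 andbT.
by apply/ler_addgt0Pl => e e0; rewrite addr0 h.
Qed.

Lemma mdist_lipschitz X (x y z : X) : `|mdist x z - mdist y z| <= mdist x y.
Proof.
have := metric_triangle x y z; have := metric_triangle y x z.
by rewrite (metric_sym y x) => ? ?; rewrite ler_norml; lra.
Qed.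

(** The distance to the limit is bounded by the tail of the geometric series,
which is [2 * 2^-n]. *)
Lemma geometric_cvg X (u : nat -> X) : complete_space X ->
  (forall n, mdist (u n) (u n.+1) <= 2^-1 ^+ n) ->
  exists l, forall n, mdist (u n) l <= 2 * 2^-1 ^+ n.
Proof.
move=> cX du.
have uu n k : mdist (u n) (u (n + k)%N) <= 2 * 2^-1 ^+ n - 2 * 2^-1 ^+ (n + k).
  elim: k => [|k ih]; first by rewrite addn0 mdistxx subrr.
  rewrite addnS; apply: le_trans (metric_triangle _ (u (n + k)%N) _) _.
  by have := du (n + k)%N; rewrite half_expS; move: ih; lra.
have {}uu n m : (n <= m)%N -> mdist (u n) (u m) < 2 * 2^-1 ^+ n.
  move=> /subnKC <-; apply: le_lt_trans (uu _ _) _.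
  by rewrite ltrBlDr ltrDl mulr_gt0// half_exp_gt0.
have cu : cauchy (u @ \oo).
  apply: cauchy_exP => e e0.
  have [|n ne] := @half_exp_lt _ (e / 2); first by rewrite divr_gt0.
  exists (u n); exists n => // m /= nm; rewrite ballEmdist/=.
  by apply: lt_trans (uu _ _ nm) _; move: ne; lra.
have [l /fcvgrPdist_lt ul] := cX _ _ cu.
exists l => n; apply/ler_addgt0Pl => e e0.
have [N _ /(_ (maxn N n))/=] := ul _ e0.
rewrite leq_maxl => /(_ isT); rewrite metric_sym => lN.
apply: le_trans (metric_triangle _ (u (maxn N n)) _) _.
by rewrite addrC lerD// ltW// uu// leq_maxr.
Qed.

Lemma dense_sequence X : separable X -> [set: X] !=set0 ->
  exists s : nat -> X, forall x e, 0 < e -> exists n, mdist x (s n) < e.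
Proof.
move=> [S /countable_injP[f finj] dS] [x0 _].
exists (fun n => xget x0 [set x | S x /\ f x = n]) => x e e0.
have /dS/(_ (open_interior _))[y [xy Sy]] : (ball x e)° !=set0.
  by exists x; apply: nbhsx_ballx.
exists (f y); case: xgetP => [z -> [Sz]|/(_ y)]; last by case.
move=> /finj -> //; rewrite ?inE//.
by move/interior_subset: xy; rewrite ballEmdist.
Qed.

(** The centres are taken in [K], so that the notion is invariant under
isometries between subsets of different spaces. *)
Definition totally_bounded X (K : set X) : Prop :=
  forall e, 0 < e -> exists A, [/\ finite_set A, A `<=` K &
    forall x, K x -> exists2 a, A a & mdist x a <= e].

(** Compactness is used in its near-covering form, with the family of finite
subsets of [K] directed by inclusion: a finite set containing [x] is
a net for the points near [x], hence some finite set is a net for all of [K]. *)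
Lemma compact_totally_bounded X (K : set X) : compact K -> totally_bounded K.
Proof.
move=> /compact_near_coveringP cK e e0.
(* The filter of properties that hold for all large enough finite subsets. *)
pose F : set_system (set X) := [set Q | exists2 A, finite_set A /\ A `<=` K &
  forall A', finite_set A' /\ A' `<=` K -> A `<=` A' -> Q A'].
have FF : Filter F.
  split.
  - by exists set0 => //; split=> //; exact: finite_set0.
  - move=> P Q [A [fA AK] AP] [C [fC CK] CQ]; exists (A `|` C).
      by split; [rewrite finite_setU|rewrite subUset].
    by move=> D hD; rewrite subUset => -[AD CD]; split; [exact: AP|exact: CQ].
  - by move=> P Q PQ [A hA AP]; exists A => // D hD AD; exact/PQ/AP.
have [x Kx|A [fA AK] /(_ A)] :=
  cK _ F (fun A x => exists2 a, A a & mdist x a <= e) FF.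
- exists (ball x e, [set A | A x]) => /=.
    split; first exact: nbhsx_ballx.
    exists [set x]; first by split; [exact: finite_set1|move=> _ ->].
    by move=> A _; apply; exact: erefl.
  case=> y A /= [xy Ax]; exists x => //.
  by move: xy; rewrite ballEmdist/= metric_sym => /ltW.
- by move=> h; exists A; split=> //; exact: h.
Qed.

Lemma compact_polish X : compact [set: X] -> polish_metric X.
Proof.
move=> cX; split.
  move=> F PF cF; have [x [_ Fx]] := cX F PF filterT; exists x.
  apply/fcvgrPdist_lt => e e0.
  have e4 : 0 < e / 4 by rewrite divr_gt0.
  have [y Fy] := (cauchyP F).1 cF _ e4.
  have [z [yz xz]] := Fx _ _ Fy (nbhsx_ballx _ _ e4).
  apply: filterS Fy => w; move: yz xz; rewrite !ballEmdist/= => yz xz yw.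
  have := metric_triangle x z w; have := metric_triangle z y w.
  by rewrite (metric_sym z y); lra.
have h n := compact_totally_bounded cX (half_exp_gt0 R n).
pose A n := projT1 (cid (h n)).
have hA n := projT2 (cid (h n)).
exists (\bigcup_n A n).
  by apply: bigcup_countable => // n _; apply: finite_set_countable; case: (hA n).
move=> O [x Ox] oO.
have : nbhs x O by exact: open_nbhs_nbhs.
rewrite -filter_from_mdist_nbhs => -[e /= e0 eO].
have [n ne] := half_exp_lt e0.
have [_ _ /(_ x I)[a Aa xa]] := hA n.
by exists a; split; [apply: eO; exact: le_lt_trans ne|exists n].
Qed.

Lemma compact_subspace X (K : set X) : compact K -> compact [set: K].
Proof.
move=> cK F PF _.
have FK : F (set_val @^-1` K) by apply: filterS filterT => x _; exact: set_valP.
have [p [Kp Fp]] := cK (set_val @ F) _ FK.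
exists (SigSub (mem_set Kp)); split=> // A V FA.
rewrite -filter_from_mdist_nbhs => -[e /= e0 eV].
have {}FA : F (set_val @^-1` (set_val @` A)).
  by apply: filterS FA => x Ax; exists x.
have [y [[x Ax <-] xe]] := Fp _ _ FA (nbhsx_ballx p e e0).
by exists x; split=> //; apply: eV; move: xe; rewrite ballEmdist.
Qed.

End MetricSpaces.

(** * Realizing one-point extensions in a Urysohn field *)

Section OnePointExtensions.
Context (R : realType) (B : metricType R) (U : field_over B).

(** These inequalities say that the [f x] can be the distances from the points
[x] of [K] to one more point, and that sending this point to [b] keeps the
projection 1-Lipschitz. *)
Definition katetov (K : set U) (f : U -> R) (b : B) : Prop :=
  (forall x y, K x -> K y ->
     `|f x - f y| <= mdist x y /\ mdist x y <= f x + f y) /\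
  (forall x, K x -> mdist (proj x) b <= f x).

Definition realizes (K : set U) (f : U -> R) (b : B) (u : U) : Prop :=
  proj u = b /\ forall x, K x -> mdist x u = f x.

Lemma katetov_ge0 K f b x : katetov K f b -> K x -> 0 <= f x.
Proof. by move=> [Kf _] Kx; have [_] := Kf x x Kx Kx; rewrite mdistxx; lra. Qed.

Section Extension.
Variables (K : set U) (f : U -> R) (b : B).
Hypotheses (Kf : katetov K f b) (f_neq0 : forall x, K x -> f x != 0).

Let d (x y : option K) : R :=
  match x, y with
  | None, None => 0
  | None, Some y => f (val y)
  | Some x, None => f (val x)
  | Some x, Some y => mdist (val x) (val y)
  end.

Let dxx x : d x x = 0.
Proof. by case: x => [x|] //=; rewrite mdistxx. Qed.

Let d_eq0 x y : d x y = 0 -> x = y.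
Proof.
case: x y => [x|] [y|] //= h.
- by congr Some; apply/val_inj/mdist_positivity.
- by have := f_neq0 (set_valP x); rewrite h eqxx.
- by have := f_neq0 (set_valP y); rewrite h eqxx.
Qed.

Let dC x y : d x y = d y x.
Proof. by case: x y => [x|] [y|] //=; rewrite metric_sym. Qed.

Let d_triangle y x z : d x z <= d x y + d y z.
Proof.
have fge0 (v : K) : 0 <= f (val v) := katetov_ge0 Kf (set_valP v).
have flip (v w : K) : f (val v) <= f (val w) + mdist (val v) (val w).
  have [+ _] := Kf.1 _ _ (set_valP v) (set_valP w).
  by rewrite ler_norml; lra.
case: x y z => [x|] [y|] [z|] //=; rewrite ?add0r ?addr0 //.
- exact: metric_triangle.
- by have := flip x y; lra.
- by have [_] := Kf.1 _ _ (set_valP x) (set_valP z).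
- by have := flip z y; rewrite metric_sym; lra.
- by have := fge0 y; lra.
Qed.

Definition extension_distance : distance_on R (option K) :=
  DistanceOn dxx d_eq0 dC d_triangle.

End Extension.

Hypothesis hU : urysohn_field U.

(** If [f] vanishes at some [x] of [K], the extension adds no point and [x]
itself realizes it; otherwise the distance on [option K] is a genuine metric. *)
Lemma realize_finite (K : set U) f b : finite_set K -> katetov K f b ->
  exists u, realizes K f b u.
Proof.
move=> finK Kf.
have [[x Kx fx0]|f_neq0] := pselect (exists2 x, K x & f x = 0).
  exists x; split.
    by apply/eq_mdist => e e0; apply: le_trans (Kf.2 x Kx) _; rewrite fx0 ltW.
  move=> y Ky; have [+ +] := Kf.1 _ _ Kx Ky.
  rewrite fx0 metric_sym ler_norml.
  by have := katetov_ge0 Kf Ky; lra.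
have {}f_neq0 x : K x -> f x != 0.
  by move=> Kx; apply/eqP => fx0; apply: f_neq0; exists x.
pose As : metricType R := metrized (extension_distance Kf f_neq0).
pose j (x : K) : As := Some x.
pose phi (x : As) : B := if x is Some x then proj (val x) else b.
have ext : one_point_extension j (None : As).
  by split=> // -[x|]; [right; exists x|left].
have phi_lip : one_lipschitz phi.
  move=> [x|] [y|]; rewrite mdist_metrized/=.
  - exact: proj_lipschitz.
  - exact/Kf.2/set_valP.
  - by rewrite metric_sym; exact/Kf.2/set_valP.
  - by rewrite mdistxx.
have [i [id ij ip]] := hU finK ext phi_lip (fun=> erefl).
exists (i None); split; first exact: ip.
move=> x Kx; pose x' : K := SigSub (mem_set Kx).
by have := id (j x') None; rewrite ij mdist_metrized.
Qed.

Lemma katetov_subset (A K : set U) f b : A `<=` K -> katetov K f b ->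
  katetov A f b.
Proof.
by move=> AK [Kf Kb]; split=> [x y /AK Kx /AK|x /AK]; [exact: Kf|exact: Kb].
Qed.

(** Both [f] and the distance to [w] are 1-Lipschitz, so agreement on a net
costs twice its mesh elsewhere. *)
Lemma realizes_net (A K : set U) f b e w : katetov K f b -> A `<=` K ->
  (forall x, K x -> exists2 a, A a & mdist x a <= e) -> realizes A f b w ->
  forall x, K x -> `|f x - mdist x w| <= 2 * e.
Proof.
move=> Kf AK netA [_ fw] x Kx; have [a Aa xa] := netA _ Kx.
have [+ _] := Kf.1 _ _ Kx (AK _ Aa); have := mdist_lipschitz x a w.
by rewrite (fw a Aa) !ler_norml; lra.
Qed.

(** The point [w] realizes [f] on a finite net of [K] and lies at distance
[t] from [v], where [t] is the largest error of [v] on [K]. The errors of [v]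
say that [f x] and [mdist x v] differ by at most [t], and [t] is at most their
sum because it is a supremum of quantities with this bound; these are the
inequalities required of the value [t] at [v]. The bound [r] itself could be too
large for the second one. *)
Lemma realize_closer (K : set U) f b v r s : totally_bounded K -> katetov K f b ->
  0 < s -> proj v = b -> (forall x, K x -> `|f x - mdist x v| <= r) ->
  exists w, [/\ K !=set0 -> mdist v w <= r, proj w = b &
    forall x, K x -> `|f x - mdist x w| <= s].
Proof.
move=> tbK Kf s0 vb fv.
(* The supremum is meaningful only over a nonempty set. *)
have [[x0 Kx0]|K0] := pselect (K !=set0); last first.
  by exists v; split=> // x Kx; exfalso; apply: K0; exists x.
pose D := [set `|f x - mdist x v| | x in K].
have D0 : D !=set0 by exists `|f x0 - mdist x0 v|; exists x0.
pose t := sup D.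
have tr : t <= r by apply: ge_sup => // _ [x Kx <-]; exact: fv.
have ft x : K x -> `|f x - mdist x v| <= t.
  by move=> Kx; apply: ub_le_sup; [exists r => _ [y Ky <-]; exact: fv|exists x].
have tf x : K x -> t <= f x + mdist x v.
  move=> Kx; apply: ge_sup => // _ [y Ky <-]; have [+ +] := Kf.1 _ _ Kx Ky.
  have := metric_triangle x v y; have := mdist_lipschitz x y v.
  by rewrite (metric_sym v y) !ler_norml; lra.
have t0 : 0 <= t by apply: le_trans (ft _ Kx0).
have [|A [finA AK netA]] := tbK (s / 2); first by rewrite divr_gt0.
pose g x := if x == v then t else f x.
have gE x : K x -> g x = f x.
  move=> Kx; rewrite /g; case: eqP => // xv; have := tf x Kx; have := ft x Kx.
  by rewrite xv mdistxx ler_norml; lra.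
have gv : g v = t by rewrite /g eqxx.
have kat : katetov (A `|` [set v]) g b.
  have mixed x : A x -> `|g x - g v| <= mdist x v /\ mdist x v <= g x + g v.
    move=> /AK Kx; rewrite (gE x Kx) gv; have := tf x Kx; have := ft x Kx.
    by rewrite !ler_norml; lra.
  split=> [x y [Ax|->] [Ay|->]|x [Ax|->]].
  - by rewrite !gE; [exact: Kf.1 (AK _ Ax) (AK _ Ay)|exact: AK..].
  - exact: mixed.
  - by rewrite distrC (addrC (g v)) metric_sym; exact: mixed.
  - by rewrite gv subrr normr0 mdistxx addr_ge0.
  - by rewrite gE; [exact/Kf.2/AK|exact: AK].
  - by rewrite gv vb mdistxx.
have finAv : finite_set (A `|` [set v]).
  by rewrite finite_setU; split=> //; exact: finite_set1.
have [w [wb gw]] := realize_finite finAv kat.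
exists w; split=> //; first by move=> _; rewrite gw ?gv//; right.
have fw : realizes A f b w.
  by split=> // a Aa; rewrite gw ?gE//; [exact: AK|left].
by move=> x /(realizes_net Kf AK netA fw); rewrite mulrCA divff ?mulr1.
Qed.

(** The errors of the successive points are at most [2^-n], and so are the
distances between them, hence they converge to a point without error. *)
Lemma realize_totally_bounded (K : set U) f b : totally_bounded K ->
  katetov K f b -> exists u, realizes K f b u.
Proof.
move=> tbK Kf.
have [[x0 Kx0]|K0] := pselect (K !=set0); last first.
  have kat0 : katetov set0 f b by split.
  have [u [ub _]] := realize_finite (finite_set0 _) kat0.
  by exists u; split=> // x Kx; exfalso; apply: K0; exists x.
pose close n v := proj v = b /\ forall x, K x -> `|f x - mdist x v| <= 2^-1 ^+ n.
have [v0 close0] : exists v, close 0 v.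
  have [|A [finA AK netA]] := tbK (1 / 2); first by rewrite divr_gt0.
  have [v fv] := realize_finite finA (katetov_subset AK Kf).
  exists v; split; first by case: fv.
  by move=> x /(realizes_net Kf AK netA fv); rewrite mulrCA divff ?mulr1.
have step n v : close n v -> exists w, mdist v w <= 2^-1 ^+ n /\ close n.+1 w.
  move=> [vb fv].
  have [w [vw wb fw]] := realize_closer tbK Kf (half_exp_gt0 R n.+1) vb fv.
  by exists w; split; [apply: vw; exists x0|].
have [u [_ uP]] := staged_choice step close0.
have [l ul] : exists l, forall n, mdist (u n) l <= 2 * 2^-1 ^+ n.
  apply: geometric_cvg => [|n]; first by case: (carrier_polish U).
  by case: (uP n).
have small e : 0 < e -> exists n, 2^-1 ^+ n <= e / 3 :> R.
  move=> e0; have [|n ne] := @half_exp_lt R (e / 3); first by rewrite divr_gt0.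
  by exists n; exact: ltW.
exists l; split=> [|x Kx].
  apply: eq_mdist => e /small[n ne]; have [[<- _] _] := uP n.
  apply: le_trans (proj_lipschitz _ _) _; rewrite metric_sym.
  by have := ul n; have := half_exp_gt0 R n; lra.
have fl (e : R) : 0 < e -> `|f x - mdist x l| <= e.
  move=> /small[n ne]; have [[_ fu] _] := uP n; have := fu x Kx; have := ul n.
  have := mdist_lipschitz (u n) l x.
  by rewrite !(metric_sym _ x) !ler_norml; lra.
apply/eqP; rewrite eq_sym -subr_eq0 -normr_le0; apply/ler_addgt0Pl => e e0.
by rewrite addr0 fl.
Qed.

End OnePointExtensions.

(** * Extending partial isometries over the base *)

Section PartialIsometries.
Context (R : realType) (B : metricType R).
Implicit Types X Y Z U : field_over B.

Definition partial_isometry X Y (P : set (X * Y)) : Prop :=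
  (forall p q, P p -> P q -> mdist p.1 q.1 = mdist p.2 q.2) /\
  (forall p, P p -> proj p.1 = proj p.2).

Definition converse X Y (P : set (X * Y)) : set (Y * X) := [set p | P (p.2, p.1)].

Definition dense_domain X Y (P : set (X * Y)) : Prop :=
  forall x e, 0 < e -> exists2 p, P p & mdist x p.1 < e.

(** The partial isometries that can be extended by one more point. *)
Definition thin X Y (P : set (X * Y)) : Prop :=
  partial_isometry P /\ totally_bounded (fst @` P).

Lemma converse_isometry X Y (P : set (X * Y)) :
  partial_isometry P -> partial_isometry (converse P).
Proof.
move=> [Pd Pp]; split=> [[y x] [y' x'] Pp1 Pp2|[y x] Pxy] /=.
  by have /= -> := Pd _ _ Pp1 Pp2.
by have /= -> := Pp _ Pxy.
Qed.

Lemma totally_bounded_range X Y (P : set (X * Y)) : thin P ->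
  totally_bounded (snd @` P).
Proof.
move=> [[Pd _] tbP] e e0; have [A [finA AP netA]] := tbP e e0.
have /choice[h hP] : forall x, exists y, A x -> P (x, y).
  move=> x; have [/AP[[x' y] Pxy /= <-]|nAx] := pselect (A x); first by exists y.
  by have [y _] := carrier_neq0 Y; exists y.
exists (h @` A); split; first exact: finite_image.
  by move=> _ [x Ax <-]; exists (x, h x); first exact: hP.
move=> _ [[x y] Pxy <-] /=; have [|a Aa xa] := netA x; first by exists (x, y).
exists (h a); first by exists a.
by have /= <- := Pd _ _ Pxy (hP _ Aa).
Qed.

Lemma converse_thin X Y (P : set (X * Y)) : thin P -> thin (converse P).
Proof.
move=> tP; split; first exact/converse_isometry/tP.1.
suff -> : fst @` converse P = snd @` P by exact: totally_bounded_range.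
by apply/seteqP; split=> y [[a b] Pab <-]; exists (b, a).
Qed.

Lemma thin_graph X Y Z (f : X -> Y) (g : X -> Z) : compact [set: X] ->
  embedding_over f -> embedding_over g -> thin [set (f x, g x) | x in [set: X]].
Proof.
move=> cX [fd fp] [gd gp]; split.
  by split=> [_ _ [x _ <-] [y _ <-]|_ [x _ <-]] /=; rewrite ?fd ?gd ?fp ?gp.
move=> e e0; have [A [finA _ netA]] := compact_totally_bounded cX e0.
exists (f @` A); split; first exact: finite_image.
  by move=> _ [x _ <-]; exists (f x, g x) => //; exists x.
move=> _ [_ [x _ <-] <-] /=; have [a Aa xa] := netA x I.
by exists (f a); [exists a|rewrite fd].
Qed.

(** A point [u] is a possible image of [x] when [mdist u y = mdist x x'] for
all [(x', y)] in [P] and [u] lies over [proj x]. As a function of [y], the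
right-hand side satisfies the Katetov inequalities since it consists of
distances to the actual point [x], read through the isometry [P]. *)
Lemma extend_domain X Y (P : set (X * Y)) x : urysohn_field Y -> thin P ->
  exists Q, [/\ P `<=` Q, thin Q & exists2 p, Q p & p.1 = x].
Proof.
move=> hY tP; have [[Pd Pp] tbP] := tP.
have /choice[h hP] : forall y, exists x', (snd @` P) y -> P (x', y).
  move=> y; have [[[x' y'] Pxy /= <-]|nPy] := pselect ((snd @` P) y).
    by exists x'.
  by exists x.
have kat : katetov (snd @` P) (fun y => mdist x (h y)) (proj x).
  split=> [y z Py Pz|y Py].
    have /= <- := Pd _ _ (hP _ Py) (hP _ Pz).
    rewrite !(metric_sym x); split; first exact: mdist_lipschitz.
    by rewrite (metric_sym (h z)); exact: metric_triangle.
  by have /= <- := Pp _ (hP _ Py); rewrite metric_sym; exact: proj_lipschitz.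
have [u [ux uP]] := realize_totally_bounded hY (totally_bounded_range tP) kat.
(* The chosen preimage of [p.2] is [p.1], as [P] is injective. *)
have xP p : P p -> mdist x p.1 = mdist u p.2.
  move=> Pp1; have Pp2 : (snd @` P) p.2 by exists p.
  rewrite (metric_sym u) uP//; congr mdist; apply: mdist_positivity.
  by have := Pd _ _ Pp1 (hP _ Pp2); rewrite mdistxx.
exists (P `|` [set (x, u)]); split; [exact: subsetUl| |by exists (x, u); [right|]].
split; first split=> [p q [Pp1|->] [Pq|->]|p [/Pp|->]] //=.
- exact: Pd.
- by rewrite metric_sym xP// metric_sym.
- exact: xP.
- by rewrite !mdistxx.
move=> e e0; have [A [finA AP netA]] := tbP e e0.
exists (A `|` [set x]); split.
- by rewrite finite_setU; split=> //; exact: finite_set1.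
- by move=> y [/AP[p Pp1 <-]|->]; [exists p => //; left|exists (x, u) => //; right].
move=> _ [p [Pp1|->] <-].
  by have [|a Aa pa] := netA p.1; [exists p|exists a => //; left].
by exists x; [right|rewrite mdistxx ltW].
Qed.

Lemma extend_range X Y (P : set (X * Y)) y : urysohn_field X -> thin P ->
  exists Q, [/\ P `<=` Q, thin Q & exists2 p, Q p & p.2 = y].
Proof.
move=> hX /converse_thin tP; have [Q [PQ tQ [q Qq qy]]] := extend_domain y hX tP.
exists (converse Q); split; [by move=> [a b] /(PQ (b, a))|exact: converse_thin|].
by exists (q.2, q.1) => //; rewrite /converse/= -surjective_pairing.
Qed.

(** Countably many requirements are met one after the other. The union is no
longer thin; a requirement is recorded as holding at some stage of the chain. *)
Lemma union_chain X Y (meets : nat -> set (X * Y) -> Prop) P0 :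
  (forall n P, thin P -> exists Q, [/\ P `<=` Q, thin Q & meets n Q]) ->
  thin P0 -> exists P, [/\ P0 `<=` P, partial_isometry P &
    forall n, exists2 Q, Q `<=` P & meets n Q].
Proof.
move=> step tP0.
have step' n P : thin P -> exists Q, (P `<=` Q /\ meets n Q) /\ thin Q.
  by move=> /(step n)[Q [PQ tQ mQ]]; exists Q.
have [u [u0 uS]] := staged_choice step' tP0.
have mono n m : (n <= m)%N -> u n `<=` u m.
  move=> /subnK <-; elim: (m - n)%N => // k ih; rewrite addSn.
  by have [_ [uk _]] := uS (k + n)%N; exact: subset_trans ih uk.
exists (\bigcup_n u n); split.
- by rewrite -u0 => p u0p; exists 0%N.
- split=> [p q [n _ np] [m _ mq]|p [n _ np]].
    have [[[d _] _] _] := uS (maxn n m).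
    by apply: d; [exact: mono (leq_maxl _ _) _ np|exact: mono (leq_maxr _ _) _ mq].
  by have [[[_ d] _] _] := uS n; exact: d.
- by move=> n; exists (u n.+1) => [p un|]; [exists n.+1|case: (uS n) => _ []].
Qed.

(** The image of [x] is the limit of the images of points of the domain that
converge to [x]. It is characterized by its distances to the range of [P], so
nothing depends on the chosen sequence. *)
Lemma extend_isometry X Y (P : set (X * Y)) : partial_isometry P ->
  dense_domain P ->
  exists phi : X -> Y, embedding_over phi /\ forall p, P p -> phi p.1 = p.2.
Proof.
move=> [Pd Pp] denP.
have /choice[phi phiP] :
    forall x, exists y, forall p, P p -> mdist y p.2 = mdist x p.1.
  move=> x.
  have /choice[s sP] : forall n, exists p, P p /\ mdist x p.1 < 2^-1 ^+ n.+1.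
    by move=> n; have [p Pp1 xp] := denP x _ (half_exp_gt0 R n.+1); exists p.
  have [|l sl] := @geometric_cvg _ Y (fun n => (s n).2) (carrier_polish Y).1.
    move=> n; have [Pn xn] := sP n; have [Pm xm] := sP n.+1.
    rewrite -(Pd _ _ Pn Pm); apply: le_trans (metric_triangle _ x _) _.
    rewrite (metric_sym _ x); move: xn xm; rewrite !half_expS.
    by have := half_exp_gt0 R n; lra.
  exists l => p Pp1.
  have lp (e : R) : 0 < e -> `|mdist l p.2 - mdist x p.1| <= e.
    move=> e0; have [|n ne] := @half_exp_lt R (e / 3); first by rewrite divr_gt0.
    have [Pn xn] := sP n; have ln := sl n; rewrite half_expS in xn.
    have := mdist_lipschitz (s n).2 l p.2; have := mdist_lipschitz x (s n).1 p.1.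
    by rewrite (Pd _ _ Pn Pp1) !ler_norml; lra.
  apply/eqP; rewrite -subr_eq0 -normr_le0; apply/ler_addgt0Pl => e e0.
  by rewrite addr0 lp.
exists phi; split; last first.
  by move=> p Pp1; apply: mdist_positivity; rewrite phiP// mdistxx.
split=> [x y|x].
  have xy (e : R) : 0 < e -> `|mdist (phi x) (phi y) - mdist x y| <= e.
    move=> e0; have [|p Pp1 xp] := denP x (e / 2); first by rewrite divr_gt0.
    have := mdist_lipschitz (phi x) p.2 (phi y); have := mdist_lipschitz x p.1 y.
    rewrite (metric_sym p.2 (phi y)) (metric_sym p.1 y) !phiP// !ler_norml; lra.
  apply/eqP; rewrite -subr_eq0 -normr_le0; apply/ler_addgt0Pl => e e0.
  by rewrite addr0 xy.
apply: eq_mdist => e e0.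
have [|p Pp1 xp] := denP x (e / 2); first by rewrite divr_gt0.
apply: le_trans (metric_triangle _ (proj p.2) _) _.
have := proj_lipschitz (phi x) p.2; have := proj_lipschitz p.1 x.
by rewrite -(Pp _ Pp1) phiP// (metric_sym p.1); lra.
Qed.

Lemma embedding_id_dense X (h : X -> X) (D : set X) : embedding_over h ->
  (forall x, D x -> h x = x) ->
  (forall x e, 0 < e -> exists2 y, D y & mdist x y < e) ->
  h =1 id.
Proof.
move=> [hd _] hD denD x; apply: eq_mdist => e e0.
have [|y Dy xy] := denD x (e / 2); first by rewrite divr_gt0.
apply: le_trans (metric_triangle _ y _) _; rewrite -{1}(hD _ Dy) hd.
by rewrite (metric_sym y); lra.
Qed.

(** The extensions of [P] and of its converse are inverse to each other on dense
sets, hence everywhere. *)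
Lemma extend_isometry_bij X Y (P : set (X * Y)) : partial_isometry P ->
  dense_domain P -> dense_domain (converse P) ->
  exists phi : X -> Y, isometry_over phi /\ forall p, P p -> phi p.1 = p.2.
Proof.
move=> Piso denP denQ.
have [phi [phie phiP]] := extend_isometry Piso denP.
have [psi [psie psiP]] := extend_isometry (converse_isometry Piso) denQ.
exists phi; split=> //; split=> //; exists psi.
  apply: (@embedding_id_dense _ _ (fst @` P)); first exact: embedding_over_comp.
    by move=> _ [[x y] Pp <-] /=; have /= -> := phiP _ Pp; exact: (psiP (y, x)).
  by move=> x e /denP-/(_ x)[p Pp xp]; exists p.1 => //; exists p.
apply: (@embedding_id_dense _ _ (snd @` P)); first exact: embedding_over_comp.
  by move=> _ [[x y] Pp <-] /=; have /= -> := psiP (y, x) Pp; exact: (phiP _ Pp).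
by move=> y e /denQ-/(_ y)[[b a] Pp xp]; exists b => //; exists (a, b).
Qed.

(** Starting from the empty partial isometry, a dense sequence of [X] is added to
the domain. *)
Lemma urysohn_universal X Y : urysohn_field Y ->
  exists phi : X -> Y, embedding_over phi.
Proof.
move=> hY; have [s sP] := dense_sequence (carrier_polish X).2 (carrier_neq0 X).
have thin0 : thin (set0 : set (X * Y)).
  split; first by split.
  by move=> e e0; exists set0; split=> // x [].
have [P [_ Piso Pn]] := union_chain (fun n P tP => extend_domain (s n) hY tP) thin0.
have [|phi [phie _]] := extend_isometry Piso; last by exists phi.
move=> x e /sP-/(_ x)[n xn]; have [Q QP [p Qp ps]] := Pn n.
by exists p; [exact: QP|rewrite ps].
Qed.

(** The back-and-forth argument: each stage adds the n-th point of a dense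
sequence to the domain and to the range, so that both become dense. *)
Lemma urysohn_homogeneous X U (f g : X -> U) : urysohn_field U ->
  compact [set: X] -> embedding_over f -> embedding_over g ->
  exists2 psi : U -> U, automorphism psi & forall x, psi (f x) = g x.
Proof.
move=> hU cX fe ge; have tfg := thin_graph cX fe ge.
have [s sP] := dense_sequence (carrier_polish U).2 (carrier_neq0 U).
pose meets n (Q : set (U * U)) :=
  (exists2 p, Q p & p.1 = s n) /\ (exists2 p, Q p & p.2 = s n).
have step n P : thin P -> exists Q, [/\ P `<=` Q, thin Q & meets n Q].
  move=> tP; have [Q [PQ tQ [p Qp ps]]] := extend_domain (s n) hU tP.
  have [Q' [QQ' tQ' Q's]] := extend_range (s n) hU tQ.
  exists Q'; split=> //; first exact: subset_trans PQ QQ'.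
  by split=> //; exists p => //; exact: QQ'.
have [P [P0 Piso Pn]] := union_chain step tfg.
have [||psi [psii psiP]] := extend_isometry_bij Piso.
- move=> x e /sP-/(_ x)[n xn]; have [Q QP [[p Qp ps] _]] := Pn n.
  by exists p; [exact: QP|rewrite ps].
- move=> x e /sP-/(_ x)[n xn]; have [Q QP [_ [p Qp ps]]] := Pn n.
  exists (p.2, p.1); last by rewrite /= ps.
  by rewrite /converse/= -surjective_pairing; exact: QP.
by exists psi => // x; apply: (psiP (f x, g x)); apply: P0; exists x.
Qed.

End PartialIsometries.

(** * Compact subsets as fields *)

Section Subfields.
Context (R : realType) (B : metricType R).

Lemma subfield_lipschitz (U : field_over B) (K : set U) :
  one_lipschitz (fun x : K => proj (set_val x)).
Proof. by move=> x y; exact: proj_lipschitz. Qed.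

Lemma subfield_neq0 (T : Type) (K : set T) : K !=set0 -> [set: K] !=set0.
Proof. by move=> [x Kx]; exists (SigSub (mem_set Kx)). Qed.

Definition subfield (U : field_over B) (K : compact_subfield U) : compact_field B :=
  let cK := compact_subspace (proj2_sig K).1 in
  exist _ (FieldOver (compact_polish cK) (subfield_neq0 (proj2_sig K).2)
    (@subfield_lipschitz U (proj1_sig K))) cK.

Lemma subfield_embedding (U : field_over B) (K : compact_subfield U) :
  @embedding_over _ _ (proj1_sig (subfield K)) U set_val.
Proof. by []. Qed.

Lemma range_subfield (U : field_over B) (K : compact_subfield U) :
  range (set_val : proj1_sig (subfield K) -> U) = proj1_sig K.
Proof.
apply/seteqP; split=> [_ [x _ <-]|x Kx]; first exact: set_valP.
by exists (SigSub (mem_set Kx)).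
Qed.

Lemma embedding_continuous (X Y : field_over B) (phi : X -> Y) :
  embedding_over phi -> continuous phi.
Proof.
move=> [phid _] x; apply/cvgrPdist_lt => e e0.
by apply: filterS (nbhsx_ballx x e e0) => y; rewrite ballEmdist/= phid.
Qed.

Lemma range_compact (X Y : field_over B) (phi : X -> Y) : compact [set: X] ->
  embedding_over phi -> compact (range phi) /\ range phi !=set0.
Proof.
move=> cX phie; split; last by have [x _] := carrier_neq0 X; exists (phi x), x.
apply: continuous_compact => //.
exact/continuous_subspaceT/embedding_continuous.
Qed.

Definition embedded_subfield (X U : field_over B) (phi : X -> U)
    (cX : compact [set: X]) (phie : embedding_over phi) : compact_subfield U :=
  exist _ (range phi) (range_compact cX phie).

End Subfields.

(** * Comparison of the two quotients *)

Section Comparison.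
Context (R : realType) (B : metricType R) (U : field_over B).
Hypothesis hU : urysohn_field U.

(** An isometry h from X to Y gives two embeddings of X in U, f and g o h, to
which homogeneity applies. Conversely an automorphism that maps the range of f
onto that of g restricts to an isometry between them. *)
Lemma isometric_range_orbit (X Y : field_over B) (f : X -> U) (g : Y -> U) :
  compact [set: X] -> embedding_over f -> embedding_over g ->
  isometric_over X Y <->
  exists2 psi : U -> U, automorphism psi & range g = psi @` range f.
Proof.
move=> cX fe ge; split=> [[h [he [k hK kK]]]|[psi [[psid psip] _] gE]].
  have [psi psia psiE] := urysohn_homogeneous hU cX fe (embedding_over_comp ge he).
  exists psi => //; rewrite image_comp; apply/seteqP; split=> _ [x _ <-].
    by exists (k x) => //=; rewrite psiE/= kK.
  by exists (h x) => //=; rewrite psiE.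
have /choice[h hE] : forall x, exists y, g y = psi (f x).
  move=> x; have [y _ yE] : range g (psi (f x)).
    by rewrite gE; exists (f x) => //; exists x.
  by exists y.
have /choice[k kE] : forall y, exists x, psi (f x) = g y.
  move=> y; have [_ [x _ <-] xE] : (psi @` range f) (g y) by rewrite -gE; exists y.
  by exists x.
have [[fd fp] [gd gp]] := (fe, ge).
exists h; split; first by split=> [x y|x]; rewrite -?gd -?gp ?hE ?psid ?fd ?psip ?fp.
exists k => [x|y]; apply: mdist_positivity.
  by rewrite -fd -psid kE hE mdistxx.
by rewrite -gd hE kE mdistxx.
Qed.

(** Not only the infima but the sets of values coincide. From Z to U: embed Z
in U by i; if a and b are automorphisms with a o f = i o phi and
b o g = i o psi, then applying the inverse of a to the images of X and Y in U
turns them into the range of f and the image of the range of g under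
a^-1 o b. From U to Z: take Z = U. *)
Lemma GH_dist_embedded (X Y : field_over B) (f : X -> U) (g : Y -> U)
    (cX : compact [set: X]) (cY : compact [set: Y])
    (fe : embedding_over f) (ge : embedding_over g) :
  GH_dist X Y = F_dist (embedded_subfield cX fe) (embedded_subfield cY ge).
Proof.
congr ereal_inf; apply/seteqP.
split=> [_ [Z [phi [psi [phie psie ->]]]]|_ [psi psia <-]].
  have [i ie] := urysohn_universal Z hU.
  have [a aa aE] := urysohn_homogeneous hU cX fe (embedding_over_comp ie phie).
  have [b ba bE] := urysohn_homogeneous hU cY ge (embedding_over_comp ie psie).
  have [a' [a'a aK a'K]] := isometry_over_inv aa.
  exists (a' \o b); first exact: isometry_over_comp.
  rewrite -(hausdorff_dist_image _ _ aa.1.1) -[RHS](hausdorff_dist_image _ _ ie.1).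
  rewrite /= !image_comp; congr hausdorff_dist; apply: eq_imagel => x _ /=.
    exact: aE.
  by rewrite a'K bE.
exists U, f, (psi \o g); split=> //.
  by apply: embedding_over_comp => //; exact: psia.1.
by rewrite /= image_comp.
Qed.

Lemma same_orbit_sym (K L : compact_subfield U) :
  same_orbit K L -> same_orbit L K.
Proof.
move=> [psi /isometry_over_inv[psi' [psi'a psiK _]] LE]; exists psi' => //.
rewrite LE image_comp -[LHS]image_id.
by apply: eq_imagel => x _; rewrite /= psiK.
Qed.

Lemma same_orbit_trans (K L M : compact_subfield U) :
  same_orbit K L -> same_orbit L M -> same_orbit K M.
Proof.
move=> [f fa LE] [g ga ME]; exists (g \o f); first exact: isometry_over_comp.
by rewrite ME LE image_comp.
Qed.

End Comparison.

Lemma eq_class (T : Type) (r : T -> T -> Prop) (x y : T) :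
  (forall x y, r x y -> r y x) -> (forall x y z, r x y -> r y z -> r x z) ->
  r x y -> class_of r x = class_of r y.
Proof.
move=> rC rT rxy; apply: eq_exist => /=; apply/funext => z; apply/propext.
by split; [apply/rT/rC|exact: rT].
Qed.

Lemma class_representative (T : Type) (r : T -> T -> Prop) (C : classes r) :
  class_of r (representative C) = C.
Proof.
case: C => C hC; apply: eq_exist; rewrite /representative.
by case: cid => x /= ->.
Qed.

Lemma inj_surj_bijective (S T : Type) (f : S -> T) :
  injective f -> (forall y, exists x, f x = y) -> bijective f.
Proof.
move=> finj /choice[g gK]; exists g => // x.
by apply: finj; rewrite gK.
Qed.

Theorem theorem3p3 (R : realType) (B : metricType R) (hB : polish_metric B)
    (U : field_over B) (hU : urysohn_field U) :
  isometric_spaces (@moduli_dist R B) (@orbit_dist R B U).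
Proof.
have /choice[e eP] : forall X : compact_field B,
    exists K : compact_subfield U, exists (phi : proj1_sig X -> U)
      (phie : embedding_over phi), K = embedded_subfield (proj2_sig X) phie.
  move=> X; have [phi phie] := urysohn_universal (proj1_sig X) hU.
  by exists (embedded_subfield (proj2_sig X) phie), phi, phie.
have same_orbitE X Y : compact_field_isometric X Y <-> same_orbit (e X) (e Y).
  have [[f [fe ->]] [g [ge ->]]] := (eP X, eP Y).
  exact (isometric_range_orbit hU (proj2_sig X) fe ge).
have F_distE X Y : F_dist (e X) (e Y) = compact_field_GH_dist X Y.
  have [[f [fe ->]] [g [ge ->]]] := (eP X, eP Y).
  by rewrite -GH_dist_embedded.
pose F (C : moduli_space B) : orbit_space U := class_of _ (e (representative C)).
exists F; split; last first.
  by move=> C D; rewrite orbit_distE -[RHS]F_distE.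
apply: inj_surj_bijective => [C D FCD|D].
  rewrite -(class_representative C) -(class_representative D).
  apply: eq_class; [by move=> X Y; exact: isometric_over_sym|
    by move=> X Y Z; exact: isometric_over_trans|].
  apply/same_orbitE; move: FCD => /(congr1 (@proj1_sig _ _))/= ->.
  exact: same_orbit_refl.
(* The class of a compact subset K, viewed as a field, is sent to the orbit of
   another copy of K in U, which is the orbit of K. *)
pose K := representative D.
pose C : moduli_space B := class_of (@compact_field_isometric R B) (subfield K).
exists C; rewrite -[RHS](class_representative D) /F.
have [f [fe ->]] := eP (representative C).
apply: eq_class; [exact: same_orbit_sym|exact: same_orbit_trans|].
rewrite /same_orbit -/K -(range_subfield K).
apply/(isometric_range_orbit hU (proj2_sig (representative C)) fe
  (subfield_embedding K)).
have /(congr1 (@proj1_sig _ _))/= CE := class_representative C.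
change (compact_field_isometric (representative C) (subfield K)); rewrite CE.
exact: isometric_over_refl.
Qed.
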